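(* Let $n$ be a positive integer with $n\equiv 11$ or $15 \pmod{20}$ and $n\neq 15$. Then there exists a configuration $(1,5)$ $GDD\left(n,2,6;2n,n-1\right)$.
   Context: A $GDD(n,2,6;\lambda_1,\lambda_2)$ is a finite collection (repetitions allowed) of $6$-element subsets, called blocks, of a $2n$-element set $X$ partitioned into two groups of size $n$, such that every point lies in the same number $r$ of blocks, any two distinct points of the same group lie together in exactly $\lambda_1$ blocks, and any two points from different groups lie together in exactly $\lambda_2$ blocks. It has configuration $(1,5)$ if every block has exactly $1$ point in one of the two groups and $5$ points in the other (which group contains the single point may depend on the block). *)

(* Defs.v *)
From mathcomp Require Import all_boot.

Set Implicit Arguments.
Unset Strict Implicit.
Unset Printing Implicit Defensive.

(* [blocks] is a sequence, so that blocks may be repeated; [count] counts them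
   with multiplicity. *)
Record is_gdd (n m k lambda1 lambda2 : nat) (X : finType)
    (groups : {set {set X}}) (blocks : seq {set X}) : Prop := IsGDD {
  gdd_card_points : #|X| = m * n;
  gdd_partition : partition groups [set: X];
  gdd_card_groups : #|groups| = m;
  gdd_group_size : forall G, G \in groups -> #|G| = n;
  gdd_block_size : forall B, B \in blocks -> #|B| = k;
  gdd_replication :
    exists r, forall x : X, count (fun B : {set X} => x \in B) blocks = r;
  gdd_same_group : forall G x y, G \in groups -> x \in G -> y \in G -> x != y ->
    count (fun B : {set X} => (x \in B) && (y \in B)) blocks = lambda1;
  gdd_diff_group : forall G H x y, G \in groups -> H \in groups -> G != H ->
    x \in G -> y \in H ->
    count (fun B : {set X} => (x \in B) && (y \in B)) blocks = lambda2 }.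

(* Meant for two groups; G and H depend on the block B. *)
Definition has_configuration (s t : nat) (X : finType)
    (groups : {set {set X}}) (blocks : seq {set X}) : Prop :=
  forall B, B \in blocks ->
    exists G H, [/\ G \in groups, H \in groups, G != H,
                    #|B :&: G| = s & #|B :&: H| = t].

(* Main.v *)
From HB Require Import structures.
Require Import Defs.
From mathcomp Require Import all_boot.
From mathcomp Require Import ssralg countalg finalg zmodp finfield zify ring.

(* Put n classes of 5-subsets on each n-point group, one class for each point c
   of the other group, and complete every 5-set of the class of c by c.  If the
   n classes together form an (n,5,2n) design and each of them covers every point
   (n-1)/2 times, the result is the required GDD.  As 2n = 6 + 4(n-3)/2, it
   suffices to have three such classes with total index 6 and two classes with
   total index 4 (split_design).

   These come from a group divisible design of type g^w on A x R, with A of order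
   g and R of odd order w, plus at most one fixed point, by filling each of the
   fibres A x {u} with a small split design.  The base blocks are
   {(l_0, 0), (l_1, t), (l_2, -t), (l_3, phi t), (l_4, - phi t)}, t in R, where
   phi, phi + 1, phi - 1 and 2 are injective on R: each difference of second
   coordinates is then a bijective function of t, and what remains is a
   condition on finitely many label vectors l over A.  If l_1 = l_2 and l_3 = l_4,
   the blocks of t and -t coincide and half of the t suffice.  Such an R exists
   as soon as 3 does not divide w exactly once.  With one fixed point, g = 10 and
   w = (n-1)/10 give n = 11 (mod 20); without it, g = 5 and w = n/5 give
   n = 15 (mod 20).  If 3 divides w exactly once, 3g and w/3 are used instead. *)

Set Implicit Arguments.
Unset Strict Implicit.
Unset Printing Implicit Defensive.

Import GRing.Theory.

(* Provides the product of two finite abelian groups, an instance that is not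
   declared by the library. *)
HB.saturate prod.

(** * From split designs to group divisible designs *)

(* The part indices 0..2 and 3..4 of a split design; a cell of k parts has index 2k. *)
Definition cells : seq (seq nat) := [:: iota 0 3; iota 3 2].

(** The replication [(#|V| - 1) / 2] is written without division, so that a nonempty [V] is forced
    to have odd size. *)
Record split_design (V : finType) (K : nat -> seq {set V}) : Prop := SplitDesign {
  split_block_size : forall i B, i < 5 -> B \in K i -> #|B| = 5;
  split_replication : forall i x, i < 5 ->
    2 * count (fun B : {set V} => x \in B) (K i) + 1 = #|V|;
  split_pairs : forall s x y, s \in cells -> x != y ->
    \sum_(i <- s) count (fun B : {set V} => (x \in B) && (y \in B)) (K i)
      = 2 * size s }.

Lemma count_sum (T : Type) (a : pred T) (s : seq T) :
  count a s = \sum_(x <- s) a x.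
Proof. by rewrite -sum1_count big_mkcond; apply: eq_bigr => x _; case: (a x). Qed.

Lemma sum_card_mem (V : finType) (s : seq {set V}) :
  \sum_(x : V) count (fun B : {set V} => x \in B) s = \sum_(B <- s) #|B|.
Proof.
under eq_bigr do rewrite count_sum.
rewrite exchange_big; apply: eq_bigr => B _ /=.
by rewrite -sum1_card [RHS]big_mkcond; apply: eq_bigr => x _; case: ifP.
Qed.

(* Classes 0, 1, 2 once each, then classes 3 and 4 alternately. *)
Definition part_of (k : nat) : nat := if k < 3 then k else 3 + odd k.

Lemma part_of_lt k : part_of k < 5.
Proof. by rewrite /part_of; case: ifP => [|_]; [lia | case: (odd k)]. Qed.

(** The first three indices contribute 6; the rest split into consecutive pairs, each meeting the
    parts 3 and 4 once and contributing 4. *)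
Lemma sum_part_of (F : nat -> nat) (n : nat) :
  (forall s, s \in cells -> \sum_(i <- s) F i = 2 * size s) ->
  odd n -> 2 < n -> \sum_(0 <= k < n) F (part_of k) = 2 * n.
Proof.
move=> HF.
have H1 : F 0 + F 1 + F 2 = 6.
  by have := HF (iota 0 3) isT; rewrite /= !big_cons big_nil; lia.
have H2 : F 3 + F 4 = 4.
  by have := HF (iota 3 2) isT; rewrite /= !big_cons big_nil; lia.
move=> n_odd n_gt2.
have -> : n = 3 + 2 * (n./2 - 1) by lia.
elim: (n./2 - 1) => [|k IHk].
  by rewrite muln0 addn0 !big_nat_recr //= big_geq.
have -> : 3 + 2 * k.+1 = (3 + 2 * k).+2 by lia.
rewrite (big_nat_recr (3 + 2 * k).+1) // (big_nat_recr (3 + 2 * k)) //= IHk /part_of.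
have -> : (3 + 2 * k < 3) = false by lia.
have -> : ((3 + 2 * k).+1 < 3) = false by lia.
have -> : odd (3 + 2 * k) by lia.
have -> : odd (3 + 2 * k).+1 = false by lia.
by rewrite /= -(addnA (2 * _)) [F (3 + 1) + _]addnC -[F _ + F _]/(F 3 + F 4) H2; lia.
Qed.

Section GddOfSplitDesign.

Variables (V : finType) (K : nat -> seq {set V}).
Hypotheses (splitK : split_design K) (V_gt2 : 2 < #|V|).

Let colour (c : V) : nat := part_of (enum_rank c).

Local Notation gdd_point := (bool * V)%type.

Definition side (b : bool) : {set gdd_point} := [set p | p.1 == b].

Definition sides : {set {set gdd_point}} := [set side b | b : bool].

Definition gdd_block (b : bool) (c : V) (B : {set V}) : {set gdd_point} :=
  (~~ b, c) |: [set (b, x) | x in B].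

Definition gdd_blocks : seq {set gdd_point} :=
  flatten [seq [seq gdd_block p.1 p.2 B | B <- K (colour p.2)]
            | p <- enum {: gdd_point}].

Lemma mem_gdd_block b c B b' x :
  ((b', x) \in gdd_block b c B) = if b' == b then x \in B else x == c.
Proof.
rewrite !inE xpair_eqE.
have -> : ((b', x) \in [set (b, x0) | x0 in B]) = (b' == b) && (x \in B).
  apply/imsetP/andP => [[z zB [-> ->]]|[/eqP-> xB]]; first by rewrite eqxx.
  by exists x.
by case: b; case: b'; rewrite /= ?orbF.
Qed.

Lemma count_gdd_blocks (a : pred {set gdd_point}) :
  count a gdd_blocks =
  \sum_(b : bool) \sum_(c : V) count (fun B => a (gdd_block b c B)) (K (colour c)).
Proof.
rewrite count_flatten sumnE !big_map pair_big /=.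
by apply: eq_bigr => p _; rewrite count_map.
Qed.

Lemma part_lt c : colour c < 5. Proof. exact: part_of_lt. Qed.

Lemma V_odd : odd #|V|.
Proof.
have /card_gt0P [x _] : 0 < #|V| by lia.
by have := split_replication splitK x (isT : 0 < 5); lia.
Qed.

Lemma half_card : 2 * (#|V| - 1)./2 = #|V| - 1.
Proof. by have := V_odd; lia. Qed.

Lemma sum_colour (F : nat -> nat) :
  (forall s, s \in cells -> \sum_(i <- s) F i = 2 * size s) ->
  \sum_(c : V) F (colour c) = 2 * #|V|.
Proof.
move=> HF; rewrite -(sum_part_of HF V_odd V_gt2) big_mkord.
by rewrite (reindex (@enum_val V V)) /=;
  [apply: eq_bigr => i _; rewrite /colour enum_valK
  | exists enum_rank => i _; rewrite ?enum_valK ?enum_rankK].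
Qed.

Lemma side_neq : side true != side false.
Proof.
have /card_gt0P [x _] : 0 < #|V| by lia.
by apply/eqP => /setP/(_ (true, x)); rewrite !inE.
Qed.

Lemma card_side b : #|side b| = #|V|.
Proof.
have -> : side b = [set (b, x) | x : V].
  apply/setP => -[b' x]; rewrite !inE /=.
  by apply/eqP/imsetP => [->|[z _ [->]]//]; exists x.
by rewrite card_imset // => x y [].
Qed.

Lemma sideP G : G \in sides -> exists b, G = side b.
Proof. by case/imsetP => b _ ->; exists b. Qed.

(** Incidences are counted in two ways: 5 per block, and [(#|V| - 1)./2] per point. *)
Lemma size_part i : i < 5 -> 10 * size (K i) = #|V| * (#|V| - 1).
Proof.
move=> i5; have /eqP := sum_card_mem (K i).
rewrite [X in _ == X](eq_big_seq (fun _ => 5)); last first.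
  by move=> B /(split_block_size splitK i5).
rewrite (eq_bigr (fun _ => (#|V| - 1)./2)); last first.
  by move=> x _; have := split_replication splitK x i5; lia.
rewrite sum_nat_const big_const_seq count_predT iter_addn_0 => /eqP.
by move=> E; rewrite -half_card mulnCA [#|V| * _]E mulnA.
Qed.

Lemma replication_half i x : i < 5 ->
  count (fun B : {set V} => x \in B) (K i) = (#|V| - 1)./2.
Proof. by move=> i5; have := split_replication splitK x i5; lia. Qed.

Lemma gdd_of_split_design : is_gdd #|V| 2 6 (2 * #|V|) (#|V| - 1) sides gdd_blocks.
Proof.
have cnt0 (T : Type) (s : seq T) : count (fun _ => false) s = 0.
  by rewrite count_pred0.
split.
- by rewrite card_prod card_bool.
- apply/and3P; split.
  + rewrite /cover eqEsubset subsetT; apply/subsetP => -[b x] _.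
    by apply/bigcupP; exists (side b); [exact: imset_f|rewrite inE].
  + apply/trivIsetP => A B /sideP[b ->] /sideP[c ->] neq.
    rewrite -setI_eq0; apply/eqP/setP => -[b' x]; rewrite !inE /=.
    by apply/negP => /andP[/eqP? /eqP?]; subst; rewrite eqxx in neq.
  + apply/negP => /sideP[b /setP].
    have /card_gt0P [x _] : 0 < #|V| by lia.
    by move/(_ (b, x)); rewrite !inE eqxx.
- rewrite card_imset ?card_bool // => b c.
  by have := side_neq; case: b; case: c => // /eqP H E; case: H.
- by move=> G /sideP[b ->]; exact: card_side.
- move=> B /flatten_mapP[[b c] _ /mapP[C CK ->]] /=.
  rewrite cardsU1 card_imset => [|x y []//].
  rewrite (split_block_size splitK (part_lt c) CK).
  by case: imsetP => // -[x _ [+ _]]; case: (b).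
(* For each [c] in the other group, a point is among the five points of [(#|V| - 1)./2] blocks; it
   is also the single point of every block of its own class, of which there are
   [#|V| * (#|V| - 1) / 10]. *)
- exists (#|V| * (#|V| - 1)./2 + (#|V| * (#|V| - 1)) %/ 10) => -[b x].
  rewrite count_gdd_blocks (bigD1 b) //= (bigD1 (~~ b)) /=; last by case: b.
  rewrite [X in _ + (_ + X)]big1 ?addn0; last by case: b => -[].
  congr (_ + _).
    rewrite -sum_nat_const; apply: eq_bigr => c _.
    rewrite -(replication_half x (part_lt c)).
    by apply: eq_count => B; rewrite mem_gdd_block eqxx.
  rewrite (bigD1 x) //= big1 ?addn0 => [|c cx].
    rewrite -(size_part (part_lt x)) mulKn // -count_predT.
    apply: eq_count => B; rewrite mem_gdd_block eqxx.
    by case: b.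
  rewrite -(cnt0 _ (K (colour c))); apply: eq_count => B.
  rewrite mem_gdd_block eq_sym [x == c]eq_sym (negbTE cx).
  by case: b.
- move=> G [b x] [b' y] /sideP[b1 ->].
  rewrite !inE /= => /eqP-> /eqP->; rewrite xpair_eqE eqxx /= => xy.
  rewrite count_gdd_blocks (bigD1 b1) //= [X in _ + X]big1 ?addn0.
    under eq_bigr => c _.
      under eq_count => B do rewrite !mem_gdd_block eqxx.
      over.
    apply: (sum_colour (F := fun i =>
      count (fun B : {set V} => (x \in B) && (y \in B)) (K i))) => s s_cell.
    exact: (split_pairs splitK).
  (* Blocks with their five points on the other side meet this side in one point only. *)
  move=> b0 bb1; apply: big1 => c _.
  rewrite -(cnt0 _ (K (colour c))); apply: eq_count => B.
  rewrite !mem_gdd_block eq_sym (negbTE bb1).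
  by apply/andP => -[/eqP ? /eqP ?]; subst; rewrite eqxx in xy.
- move=> G H [b x] [b' y] /sideP[b1 ->] /sideP[b2 ->] neq.
  rewrite !inE /= => /eqP ? /eqP ?; subst b1 b2.
  have {neq} ? : b' = ~~ b by case: b b' neq => -[]; rewrite ?eqxx.
  subst b'.
  (* If [v] is the single point, the block comes from the class of [v] and passes through [u].
     Either point of the pair can be the single one, hence the total [#|V| - 1]. *)
  have half b0 u v : \sum_(c : V) count (fun B =>
      ((b0, u) \in gdd_block b0 c B) && ((~~ b0, v) \in gdd_block b0 c B))
      (K (colour c)) = (#|V| - 1)./2.
    rewrite (bigD1 v) //= big1 ?addn0 => [|c cx].
      rewrite -(replication_half u (part_lt v)); apply: eq_count => B.
      by rewrite !mem_gdd_block !eqxx; case: b0; rewrite /= andbT.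
    rewrite -(cnt0 _ (K (colour c))); apply: eq_count => B.
    rewrite !mem_gdd_block [v == c]eq_sym (negbTE cx).
    by case: b0; rewrite /= andbF.
  rewrite count_gdd_blocks (bigD1 b) //= (bigD1 (~~ b)) /=; last by case: b.
  rewrite [X in _ + (_ + X)]big1 ?addn0; last by case: b => -[].
  rewrite half.
  have -> : \sum_(i : V) count (fun B => ((b, x) \in gdd_block (~~ b) i B) &&
       ((~~ b, y) \in gdd_block (~~ b) i B)) (K (colour i)) = (#|V| - 1)./2.
    rewrite -(half (~~ b) y x); apply: eq_bigr => c _; apply: eq_count => B.
    by rewrite andbC negbK.
  by rewrite addnn -mul2n half_card.
Qed.

Lemma gdd_configuration : has_configuration 1 5 sides gdd_blocks.
Proof.
move=> B /flatten_mapP[[b c] _ /mapP[C CK ->]] /=.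
exists (side (~~ b)), (side b); split.
- exact: imset_f.
- exact: imset_f.
- by case: (b) => /=; [rewrite eq_sym|]; exact: side_neq.
- have -> : gdd_block b c C :&: side (~~ b) = [set (~~ b, c)].
    apply/setP => -[b' x]; rewrite inE mem_gdd_block !inE xpair_eqE /=.
    by case: (b); case: b'; rewrite ?andbT ?andbF.
  by rewrite cards1.
- rewrite -(split_block_size splitK (part_lt c) CK).
  have -> : gdd_block b c C :&: side b = [set (b, x) | x in C].
    apply/setP => -[b' x]; rewrite inE mem_gdd_block !inE /=.
    apply/andP/imsetP => [[+ /eqP e]|[z zC [-> ->]]].
      by rewrite e eqxx => xC; exists x.
    by rewrite eqxx.
  by rewrite card_imset // => x y [].
Qed.

End GddOfSplitDesign.

(** * Small split designs *)

(** The blocks through [x] are filtered once, before [y] varies, to keep the evaluation cheap. *)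
Definition split_design_on_nat (v : nat) (K : nat -> seq (seq nat)) : bool :=
  all (fun i => all (fun b => [&& size b == 5, uniq b & all (gtn v) b]) (K i) &&
    all (fun x => 2 * count (fun b : seq nat => x \in b) (K i) + 1 == v) (iota 0 v))
    (iota 0 5) &&
  all (fun s => all (fun x =>
    let Kx := [seq [seq b : seq nat <- K i | x \in b] | i <- s] in
    all (fun y => (x != y) ==>
      (sumn [seq count (fun b : seq nat => y \in b) bs | bs <- Kx] == 2 * size s))
    (iota 0 v)) (iota 0 v)) cells.

Lemma split_design_of_nat (V : finType) (K : nat -> seq (seq nat)) :
  split_design_on_nat #|V| K ->
  split_design (fun i =>
    [seq [set x : V | (enum_rank x : nat) \in b] | b : seq nat <- K i]).
Proof.
case/andP => /allP H1 /allP H2; have rk (x : V) : (enum_rank x : nat) \in iota 0 #|V|.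
  by rewrite mem_iota ltn_ord.
have {}H1 i : i < 5 -> _ := fun i5 => H1 i (etrans (mem_iota 0 5 i) i5).
split.
- move=> i B i5 /mapP[b bK ->].
  have /andP[/allP/(_ _ bK)/and3P[/eqP sz ub lb] _] := H1 i i5.
  have -> : [set x : V | (enum_rank x : nat) \in b]
      = [set enum_val k | k in (pmap insub b : seq 'I_#|V|)].
    apply/setP => x; rewrite inE; apply/idP/imsetP => [xb|[k + ->]].
      by exists (enum_rank x); rewrite ?mem_pmap_sub ?enum_rankK.
    by rewrite mem_pmap_sub enum_valK.
  rewrite card_imset; last exact: enum_val_inj.
  rewrite (card_uniqP (pmap_sub_uniq _ ub)) size_pmap_sub -sz.
  by apply/eqP; rewrite -all_count.
- move=> i x i5.
  have /andP[_ /allP/(_ _ (rk x))/eqP e] := H1 i i5; apply: etrans e.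
  by rewrite count_map; congr (2 * _ + 1); apply: eq_count => b; rewrite /= inE.
- move=> s x y /H2/allP/(_ _ (rk x))/allP/(_ _ (rk y))/implyP + xy.
  rewrite (inj_eq val_inj) (inj_eq enum_rank_inj) => /(_ xy)/eqP <-.
  rewrite -map_comp sumnE big_map; apply: eq_bigr => i _ /=.
  by rewrite count_map count_filter; apply: eq_count => b; rewrite /= !inE andbC.
Qed.

Definition develop (p : nat -> nat) (k : nat) (bs : seq (seq nat)) : seq (seq nat) :=
  [seq [seq iter i p x | x <- b] | b <- bs, i <- iota 0 k].

Definition fill5 (i : nat) : seq (seq nat) := nseq 2 (iota 0 5).

(** The nonzero squares modulo 11 form the Paley (11,5,2) difference set. *)
Definition fill11 (i : nat) : seq (seq nat) :=
  develop (fun x => x.+1 %% 11) 11 [:: [:: 1; 3; 4; 5; 9]].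

(** The base blocks are H, 3H and 9H for the subgroup H of order 5 generated by 2 in the units
    modulo 31. The differences within H fill two cosets of the group generated by H and -1, for
    which 1, 3, 9 are coset representatives; so every nonzero difference occurs twice. *)
Definition fill31 (i : nat) : seq (seq nat) :=
  develop (fun x => x.+1 %% 31) 31
    [:: [:: 1; 2; 4; 8; 16]; [:: 3; 6; 12; 24; 17]; [:: 9; 18; 5; 10; 20]].

(* Rotation of order 7 of 'Z_7 x {0, 1} plus a fixed point, coded as
   0..6, 7..13 and 14. *)
Definition rot15 (x : nat) : nat :=
  if x < 7 then x.+1 %% 7 else if x < 14 then 7 + (x - 6) %% 7 else x.

(* The three parts of index 6 and the two parts of index 4 were found by computer
   search; no (15,5,2) design exists, so that index 2 per part is impossible here. *)
Definition fill15 (i : nat) : seq (seq nat) :=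
  develop rot15 7 (nth [::]
    [:: [:: [:: 1; 5; 6; 10; 14]; [:: 2; 5; 10; 11; 12]; [:: 1; 2; 7; 9; 11]];
        [:: [:: 3; 8; 12; 13; 14]; [:: 1; 2; 3; 7; 11]; [:: 0; 2; 4; 10; 11]];
        [:: [:: 0; 3; 7; 10; 14]; [:: 0; 1; 4; 6; 12]; [:: 5; 9; 11; 12; 13]];
        [:: [:: 0; 7; 9; 12; 14]; [:: 2; 3; 5; 6; 9]; [:: 0; 1; 8; 9; 12]];
        [:: [:: 1; 5; 6; 11; 14]; [:: 3; 5; 9; 11; 12]; [:: 4; 6; 7; 8; 9]]] i).

Lemma fill5P : split_design_on_nat 5 fill5. Proof. by vm_compute. Qed.
Lemma fill11P : split_design_on_nat 11 fill11. Proof. by vm_compute. Qed.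
Lemma fill15P : split_design_on_nat 15 fill15. Proof. by vm_compute. Qed.
Lemma fill31P : split_design_on_nat 31 fill31. Proof. by vm_compute. Qed.

(** * Translates of base blocks *)

Section Development.

Variables (D : finZmodType) (E : finType).

(** [E] consists of points fixed by all translations; developed blocks avoid it. *)
Definition translate (g : seq D) (z : D) : {set D + E} :=
  [set inl (y + z)%R | y in g].

Definition develop_bases (gs : seq (seq D)) : seq {set D + E} :=
  flatten [seq [seq translate g z | z <- enum D] | g <- gs].

Lemma mem_translate_inl g z p : uniq g ->
  ((inl p \in translate g z) : nat) = \sum_(y <- g) ((y + z)%R == p).
Proof.
move=> ug; have -> : (inl p \in translate g z) = ((p - z)%R \in g).
  apply/imsetP/idP => [[y yg [->]]|pg]; first by rewrite addrK.
  by exists (p - z)%R; rewrite ?subrK.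
rewrite -(count_uniq_mem _ ug) count_sum; apply: eq_bigr => y _ /=.
by rewrite eq_sym subr_eq eq_sym.
Qed.

Lemma mem_translate_inr g z e : (inr e \in translate g z) = false.
Proof. by apply/imsetP => -[]. Qed.

Lemma card_translate g z : uniq g -> #|translate g z| = size g.
Proof.
move=> ug; rewrite card_imset ?(card_uniqP ug) //.
by move=> x y [] /addIr.
Qed.

Lemma count_develop a gs :
  count a (develop_bases gs) = \sum_(g <- gs) \sum_(z : D) a (translate g z).
Proof.
rewrite count_flatten sumnE !big_map; apply: eq_bigr => g _.
by rewrite count_map count_sum big_enum.
Qed.

Lemma sum_translates g p : \sum_(z : D) \sum_(y <- g) ((y + z)%R == p) = size g.
Proof.
rewrite exchange_big /= -[RHS]count_predT count_sum; apply: eq_bigr => y _.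
rewrite (bigD1 (p - y)%R) //= addrC subrK eqxx big1 // => z /negbTE.
by rewrite eq_sym subr_eq eq_sym addrC => ->.
Qed.

(** Difference method: [p] and [q] lie in the translate by [z] exactly when [z = p - y = q - y']
    with [y], [y'] in [g]; for given [y], [y'] such a [z] exists, and is unique, iff
    [y - y' = p - q]. *)
Lemma sum_translates_pair g p q : uniq g ->
  \sum_(z : D) ((inl p \in translate g z) && (inl q \in translate g z))
  = \sum_(y <- g) \sum_(y' <- g) ((y - y')%R == (p - q)%R).
Proof.
move=> ug; under [LHS]eq_bigr do rewrite -mulnb !mem_translate_inl // big_distrlr /=.
rewrite exchange_big; apply: eq_bigr => y _; rewrite exchange_big.
apply: eq_bigr => y' _; rewrite (bigD1 (p - y)%R) //= [X in (X == p) * _]addrC subrK eqxx.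
rewrite mul1n big1 ?addn0 => [|z /negbTE zp].
  congr nat_of_bool; rewrite addrA subr_eq [RHS]eq_sym [RHS]subr_eq -[in RHS](inj_eq (addrI y')).
  by rewrite addrA [(y' + (y - y'))%R]addrC subrK [(q + y)%R]addrC.
by rewrite [(y + z)%R]addrC [_ == p]eq_sym -subr_eq eq_sym zp.
Qed.

End Development.

(** * Level groups *)

Record level (R : finZmodType) (phi : R -> R) : Prop := Level {
  level_opp : forall x, phi (- x)%R = (- phi x)%R;
  level_inj : injective phi;
  level_double : injective (fun x : R => x + x)%R;
  level_add : injective (fun x => x + phi x)%R;
  level_sub : injective (fun x => x - phi x)%R }.

Section Level.

Variables (R : finZmodType) (phi : R -> R).
Hypothesis phiP : level phi.

Definition form (i : nat) (t : R) : R := nth 0%R [:: 0; t; - t; phi t; - phi t]%R i.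

(* The permutation of the five positions induced by t |-> -t. *)
Definition swap (i : nat) : nat := nth 0 [:: 0; 2; 1; 4; 3] i.

Lemma opp_eq_self (x : R) : (- x)%R = x -> x = 0%R.
Proof.
move=> xx; apply: (level_double phiP).
by rewrite addr0 -{1}xx addNr.
Qed.

Lemma level0 : phi 0%R = 0%R.
Proof. by apply: opp_eq_self; rewrite -(level_opp phiP) oppr0. Qed.

Lemma form0 i : form i 0%R = 0%R.
Proof. by rewrite /form level0 oppr0; case: i => [|[|[|[|[|[|]]]]]]. Qed.

Lemma form_opp i t : form i (- t)%R = form (swap i) t.
Proof.
rewrite /form (level_opp phiP) !opprK.
by case: i => [|[|[|[|[|[|]]]]]].
Qed.

(** Up to sign the difference is [t], [phi t], [t + t], [phi t + phi t], [t + phi t] or [t - phi t],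
    all injective by [level]. *)
Lemma form_diff_inj i j : i < 5 -> j < 5 -> i != j ->
  injective (fun t => form i t - form j t)%R.
Proof.
wlog: i j / i < j.
  move=> W i5 j5 ij; have := ij; rewrite neq_ltn => /orP[/W|ji]; first exact.
  move=> x y E; apply: (W j i) => //; first by rewrite eq_sym.
  by rewrite -opprB E opprB.
case: phiP => _ i0 i1 i2 i3.
case: j i => [|[|[|[|[|//]]]]] [|[|[|[|//]]]] // _ _ _ _ x y;
  rewrite /form /= ?sub0r ?opprK -?opprD.
- exact: oppr_inj.
- by [].
- exact: i1.
- by move/oppr_inj/i0.
- by move/oppr_inj/i2.
- exact: i0.
- exact: i2.
- by rewrite ![(- _ + phi _)%R]addrC -![(phi _ - _)%R]opprB => /oppr_inj/i3.
- by move/i1/i0.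
Qed.

Lemma form_uniq t : t != 0%R -> forall i j, i < 5 -> j < 5 -> form i t = form j t -> i = j.
Proof.
move=> t0 i j i5 j5 E; apply/eqP; apply: contraNT t0 => ij; apply/eqP.
by apply: (form_diff_inj i5 j5 ij); rewrite E !form0 !subrr.
Qed.

(** For distinct positions the difference permutes [R] and fixes 0, so a nonzero [d] is reached from
    exactly one nonzero [t]. *)
Lemma sum_form_diff i j d : i < 5 -> j < 5 -> d != 0%R ->
  \sum_(t | t != 0%R) ((form i t - form j t)%R == d) = (i != j).
Proof.
move=> i5 j5 d0; have [->|ij] := eqVneq i j.
  by apply: big1 => t _; rewrite subrr eq_sym (negbTE d0).
have [g fK gK] := injF_bij (form_diff_inj i5 j5 ij).
rewrite (bigD1 (g d)) /=; last first.
  by apply: contra_neq d0 => gd0; rewrite -[d]gK gd0 !form0 subrr.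
rewrite gK eqxx big1 // => t /andP[_ tg].
by apply/eqP; rewrite eqb0; apply: contra_neq tg => <-; rewrite fK.
Qed.

(* One element from each pair {t, -t} with t <> 0. *)
Definition half_system : pred R := fun t => enum_rank t < enum_rank (- t)%R.

(** As doubling is injective, 0 is the only self-opposite element, and negation exchanges the half
    system with the other nonzero elements. *)
Lemma sum_half (F : R -> nat) : (forall t, F (- t)%R = F t) ->
  2 * \sum_(t | half_system t) F t = \sum_(t | t != 0%R) F t.
Proof.
move=> FN; rewrite [RHS](bigID half_system) /=.
have -> : \sum_(t | (t != 0%R) && half_system t) F t = \sum_(t | half_system t) F t.
  apply: eq_bigl => t; apply: andb_idl; apply: contraL => /eqP->.
  by rewrite /half_system oppr0 ltnn.
have -> : \sum_(t | (t != 0%R) && ~~ half_system t) F t = \sum_(t | half_system t) F t.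
  rewrite [LHS](reindex_inj oppr_inj); apply: eq_big => // t.
  rewrite /half_system opprK oppr_eq0 -leqNgt ltn_neqAle; congr (_ && _).
  rewrite (inj_eq val_inj) (inj_eq enum_rank_inj); congr (~~ _).
  by apply/eqP/eqP => [->|/esym/opp_eq_self//]; rewrite oppr0.
by rewrite mul2n addnn.
Qed.

Lemma card_half : 2 * #|half_system| + 1 = #|R|.
Proof.
rewrite -sum1_card sum_half // sum1_card addn1.
by rewrite [RHS](cardD1 (0%R : R)) inE add1n; congr _.+1; apply: eq_card => t; rewrite !inE andbT.
Qed.
End Level.

(** * Inflation *)

(** Positions are distinct, labels need not be: equal labels contribute to [a = 0], which serves
    pairs with the same [A]-coordinate in different fibres. *)
Definition label_diff (A : finZmodType) (l : seq A) (a : A) : nat :=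
  \sum_(0 <= i < 5) \sum_(0 <= j < 5 | i != j) ((l`_i - l`_j)%R == a).

Definition even_label (A : finZmodType) (l : seq A) : bool :=
  (l`_1 == l`_2)%R && (l`_3 == l`_4)%R.

(* Es holds labels used with t in a half system only, Ps labels used with all
   t <> 0; the weight is therefore twice the number of blocks through a pair. *)
Definition label_weight (A : finZmodType) (Es Ps : seq (seq A)) (a : A) : nat :=
  \sum_(l <- Es) label_diff l a + 2 * \sum_(l <- Ps) label_diff l a.

Section Inflation.

Variables (A R : finZmodType) (phi : R -> R) (E : finType).
Hypotheses (phiP : level phi) (E_le1 : #|E| <= 1).

Let D : finZmodType := (A * R)%type.

Definition base_block (l : seq A) (t : R) : seq D :=
  [seq (l`_i, form phi i t)%R | i <- index_iota 0 5].

Definition base_blocks (Es Ps : seq (seq A)) : seq (seq D) :=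
  flatten [seq [seq base_block l t | t <- enum (@half_system R)] | l <- Es] ++
  flatten [seq [seq base_block l t | t <- enum (predC1 (0%R : R))] | l <- Ps].

Lemma base_block_uniq l t : t != 0%R -> uniq (base_block l t).
Proof.
move=> t0; rewrite map_inj_in_uniq ?iota_uniq // => i j.
rewrite !mem_index_iota => i5 j5 [_]; exact: form_uniq.
Qed.

Lemma half_neq0 (t : R) : half_system t -> t != 0%R.
Proof. by apply: contraL => /eqP->; rewrite /half_system oppr0 ltnn. Qed.

Lemma base_blocksP Es Ps g : g \in base_blocks Es Ps ->
  exists l t, t != 0%R /\ g = base_block l t.
Proof.
rewrite mem_cat => /orP[] /flatten_mapP[l _ /mapP[t]];
  rewrite mem_enum => t0 ->; exists l, t; split=> //.
exact: half_neq0.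
Qed.

Lemma sum_base_blocks Es Ps (F : seq D -> nat) :
  \sum_(g <- base_blocks Es Ps) F g =
  \sum_(l <- Es) \sum_(t | half_system t) F (base_block l t) +
  \sum_(l <- Ps) \sum_(t | t != 0%R) F (base_block l t).
Proof.
by rewrite big_cat !big_flatten !big_map /=; congr (_ + _); apply: eq_bigr => l _;
  rewrite big_map big_enum.
Qed.

Definition diff_count (g : seq D) (d : D) : nat :=
  \sum_(y <- g) \sum_(y' <- g) ((y - y')%R == d).

Lemma diff_count_base l t a d : diff_count (base_block l t) (a, d) =
  \sum_(0 <= i < 5) \sum_(0 <= j < 5)
    ((l`_i - l`_j)%R == a) * ((form phi i t - form phi j t)%R == d).
Proof.
rewrite /diff_count big_map; apply: eq_bigr => i _; rewrite big_map.
by apply: eq_bigr => j _; rewrite mulnb.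
Qed.

(** A nonzero [t] gives five distinct second coordinates, so pairs inside a fibre are left entirely
    to its filling. *)
Lemma diff_count_vertical l t a : t != 0%R -> a != 0%R ->
  diff_count (base_block l t) (a, 0%R) = 0.
Proof.
move=> t0 a0; rewrite diff_count_base big_nat big1 // => i i5.
rewrite big_nat big1 // => j j5; rewrite subr_eq0.
have [e|_] := eqVneq (form phi i t) (form phi j t); last by rewrite muln0.
by rewrite (form_uniq phiP t0 i5 j5 e) subrr eq_sym (negbTE a0).
Qed.

Lemma sum_diff_count l a d : d != 0%R ->
  \sum_(t | t != 0%R) diff_count (base_block l t) (a, d) = label_diff l a.
Proof.
move=> d0; under eq_bigr do rewrite diff_count_base.
rewrite exchange_big; apply: eq_big_nat => i i5 /=.
rewrite exchange_big [RHS]big_mkcond; apply: eq_big_nat => j j5 /=.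
by rewrite -big_distrr (sum_form_diff phiP) //=; case: (i != j); rewrite ?muln0 ?muln1.
Qed.

Lemma sum_swap (F : nat -> nat) : \sum_(0 <= i < 5) F (swap i) = \sum_(0 <= i < 5) F i.
Proof. by rewrite /index_iota unlock /= /swap /=; lia. Qed.

Lemma even_label_swap (l : seq A) i : even_label l -> i < 5 -> (l`_(swap i) = l`_i)%R.
Proof.
by case/andP => /eqP e1 /eqP e2; case: i => [|[|[|[|[|]]]]] //= _; rewrite /swap /= ?e1 ?e2.
Qed.

(** For an even label, passing from [t] to [-t] only permutes the positions by [swap], so [sum_half]
    applies. *)
Lemma sum_diff_count_half l a d : even_label l -> d != 0%R ->
  2 * \sum_(t | half_system t) diff_count (base_block l t) (a, d) = label_diff l a.
Proof.
move=> l_even d0; rewrite (sum_half phiP) ?sum_diff_count // => t.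
rewrite !diff_count_base -[RHS]sum_swap; apply: eq_big_nat => i i5.
rewrite -[RHS]sum_swap; apply: eq_big_nat => j j5.
by rewrite !even_label_swap // !(form_opp phiP).
Qed.

Lemma sum_diff_count_base_blocks Es Ps a d : all (@even_label A) Es -> d != 0%R ->
  2 * \sum_(g <- base_blocks Es Ps) diff_count g (a, d) = label_weight Es Ps a.
Proof.
move=> /allP E_even d0; rewrite sum_base_blocks mulnDr; congr (_ + _).
  rewrite big_distrr; apply: eq_big_seq => l lE /=.
  by rewrite sum_diff_count_half // E_even.
by congr (2 * _); apply: eq_bigr => l _; rewrite sum_diff_count.
Qed.

Lemma size_base_blocks Es Ps :
  2 * size (base_blocks Es Ps) = (size Es + 2 * size Ps) * (#|R| - 1).
Proof.
have eH : \sum_(t : R | half_system t) 1 = #|@half_system R| by rewrite sum1_card.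
have eN : \sum_(t : R | t != 0%R) 1 = 2 * #|@half_system R|.
  by rewrite -(sum_half phiP (F := fun=> 1)) // eH.
rewrite -[size _]count_predT count_sum sum_base_blocks /= eH eN.
rewrite !big_const_seq !count_predT !iter_addn_0.
have -> : #|R| - 1 = 2 * #|@half_system R| by rewrite -(card_half phiP) addnK.
by ring.
Qed.

Definition spread (u : R) (x : A + E) : D + E :=
  match x with inl a => inl (a, u) | inr e => inr e end.

Lemma spread_inj u : injective (spread u).
Proof. by move=> [a|e] [b|e'] //= [->]. Qed.

Definition fill_blocks (bs : seq {set A + E}) : seq {set D + E} :=
  flatten [seq [seq spread u @: B | B : {set A + E} <- bs] | u <- enum R].

Lemma mem_spread_inl u u' a (B : {set A + E}) :
  (inl (a, u') \in spread u @: B) = (u' == u) && (inl a \in B).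
Proof.
apply/imsetP/andP => [[[b|e] bB //= [-> ->]]|[/eqP-> aB]]; first by rewrite eqxx.
by exists (inl a).
Qed.

Lemma mem_spread_inr u e (B : {set A + E}) :
  (inr e \in spread u @: B) = (inr e \in B).
Proof.
apply/imsetP/idP => [[[b|e'] bB //= [->]]//|eB]; by exists (inr e).
Qed.

Lemma count_fill a bs :
  count a (fill_blocks bs) = \sum_(u : R) count (fun B : {set A + E} => a (spread u @: B)) bs.
Proof.
rewrite count_flatten sumnE !big_map; apply: eq_bigr => u _.
by rewrite count_map.
Qed.

Definition inflate (bs : seq {set A + E}) (Es Ps : seq (seq A)) : seq {set D + E} :=
  fill_blocks bs ++ develop_bases E (base_blocks Es Ps).

Lemma subsingleton_E (e e' : E) : e = e'.
Proof.
apply/eqP; have := E_le1; rewrite leqNgt; apply: contraNT => ee.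
by apply/card_gt1P; exists e, e'.
Qed.

Variables (K : nat -> seq {set A + E}) (Es Ps : nat -> seq (seq A)).
(** The filling leaves a point outside [E] short of [#|A| * (#|R| - 1) / 2] blocks, and the
    translates of one base block cover it 5 times; this dictates [replication_weight]. In
    [pair_weight] the index [2 * size s] is doubled because [label_weight] is. *)
Hypotheses (splitK : split_design K)
  (Es_even : forall i, i < 5 -> all (@even_label A) (Es i))
  (replication_weight : forall i, i < 5 -> 5 * (size (Es i) + 2 * size (Ps i)) = #|A|)
  (pair_weight : forall s a, s \in cells ->
     \sum_(i <- s) label_weight (Es i) (Ps i) a = 4 * size s).

Lemma cells_lt s i : s \in cells -> i \in s -> i < 5.
Proof. by rewrite !inE => /orP[]/eqP->; rewrite mem_iota; lia. Qed.

Lemma count_false (T : Type) (a : pred T) s : a =1 pred0 -> count a s = 0.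
Proof. by move/eq_count->; rewrite count_pred0. Qed.

Lemma inflate_block_size i B :
  i < 5 -> B \in inflate (K i) (Es i) (Ps i) -> #|B| = 5.
Proof.
move=> i5; rewrite mem_cat => /orP[] /flatten_mapP[].
  move=> u _ /mapP[C CK ->]; rewrite card_imset; last exact: spread_inj.
  exact: (split_block_size splitK i5 CK).
move=> g /base_blocksP[l [t [t0 ->]]] /mapP[z _ ->].
by rewrite card_translate ?base_block_uniq // size_map size_iota.
Qed.

Lemma inflate_replication i x : i < 5 ->
  2 * count (fun B : {set D + E} => x \in B) (inflate (K i) (Es i) (Ps i)) + 1
    = #|{: D + E}|.
Proof.
move=> i5; have Rgt0 : 0 < #|R| by apply/card_gt0P; exists 0%R.
rewrite count_cat count_fill count_develop card_sum card_prod.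
case: x => [[a u]|e].
  rewrite (bigD1 u) //= [X in _ + X + _]big1 ?addn0 => [|v vu]; last first.
    by apply: count_false => B; rewrite mem_spread_inl eq_sym (negbTE vu).
  rewrite (eq_count (a2 := fun B : {set A + E} => inl a \in B)); last first.
    by move=> B; rewrite mem_spread_inl eqxx.
  rewrite (eq_big_seq (fun=> 5)); last first.
    move=> g /base_blocksP[l [t [t0 ->]]].
    under eq_bigr do rewrite mem_translate_inl ?base_block_uniq //.
    by rewrite sum_translates size_map size_iota.
  rewrite big_const_seq count_predT iter_addn_0.
  have := split_replication splitK (inl a) i5; rewrite card_sum.
  have : 10 * size (base_blocks (Es i) (Ps i)) = #|A| * (#|R| - 1).
    by rewrite -[10]/(5 * 2) -mulnA size_base_blocks mulnA replication_weight.
  rewrite mulnBr muln1; have : #|A| <= #|A| * #|R| by rewrite leq_pmulr.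
  (* Here [v] and [w] stand for [#|A|] and [#|A| * #|R|], which makes the problem linear. *)
  have arith (v w z e c : nat) :
    v <= w -> 10 * z = w - v -> 2 * c + 1 = v + e -> 2 * (c + 5 * z) + 1 = w + e by lia.
  exact: arith.
rewrite [\sum_(g <- base_blocks _ _) _]big1 ?addn0; last first.
  by move=> g _; apply: big1 => z _; rewrite mem_translate_inr.
rewrite (eq_bigr (fun=> count (fun B : {set A + E} => inr e \in B) (K i))); last first.
  by move=> u _; apply: eq_count => B; rewrite mem_spread_inr.
rewrite sum_nat_const.
(* The fixed point is shared by all [#|R|] filled fibres, with replication [#|A| / 2] in each. *)
have E1 : #|E| = 1 by apply/eqP; rewrite eqn_leq E_le1; apply/card_gt0P; exists e.
have := split_replication splitK (inr e) i5; rewrite card_sum E1.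
by move/addIn => <-; rewrite mulnCA mulnC.
Qed.

(** A pair inside a fibre, or with a fixed point, is covered by the filling of one fibre only; a
    pair from different fibres by translates only. *)
Lemma inflate_pairs_inl s p y : s \in cells -> inl p != y ->
  \sum_(i <- s) count (fun B : {set D + E} => (inl p \in B) && (y \in B))
    (inflate (K i) (Es i) (Ps i)) = 2 * size s.
Proof.
move=> s_cell; under eq_bigr do rewrite count_cat count_fill count_develop.
case: p y => a u [[b v]|e] xy; last first.
  rewrite -(split_pairs splitK s_cell (isT : inl a != inr e :> A + E)).
  apply: eq_bigr => i _; rewrite [\sum_(g <- _) _]big1 ?addn0; last first.
    by move=> g _; apply: big1 => z _; rewrite mem_translate_inr andbF.
  rewrite (bigD1 u) //= big1 ?addn0 => [|w wu].
    by apply: eq_count => B; rewrite mem_spread_inl mem_spread_inr eqxx.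
  by apply: count_false => B; rewrite mem_spread_inl eq_sym (negbTE wu).
have dev i : \sum_(g <- base_blocks (Es i) (Ps i)) \sum_z
    ((inl (a, u) \in translate E g z) && (inl (b, v) \in translate E g z))
  = \sum_(g <- base_blocks (Es i) (Ps i)) diff_count g (a - b, u - v)%R.
  apply: eq_big_seq => g /base_blocksP[l [t [t0 ->]]].
  by rewrite sum_translates_pair // base_block_uniq.
under eq_bigr do rewrite dev.
have [uv|uv] := eqVneq u v; last first.
  have uv0 : (u - v != 0)%R by rewrite subr_eq0.
  apply/eqP; rewrite -(eqn_pmul2l (isT : 0 < 2)) mulnA -(pair_weight (a - b)%R s_cell).
  rewrite big_distrr; apply/eqP; apply: eq_big_seq => i /(cells_lt s_cell) i5 /=.
  rewrite mulnDr sum_diff_count_base_blocks ?Es_even // big1 // => w _.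
  apply: count_false => B; rewrite !mem_spread_inl.
  by case: eqVneq => // <-; rewrite eq_sym (negbTE uv) andbF.
subst v; have ab : a != b by apply: contra_neq xy => ->.
have iab : inl a != inl b :> A + E by apply: contra_neq ab => -[].
rewrite -(split_pairs splitK s_cell iab); apply: eq_bigr => i _.
rewrite subrr [X in _ + X]big1_seq ?addn0; last first.
  move=> g /andP[_ /base_blocksP[l [t [t0 ->]]]].
  by rewrite diff_count_vertical // subr_eq0.
rewrite (bigD1 u) //= big1 ?addn0 => [|w wu].
  by apply: eq_count => B; rewrite !mem_spread_inl eqxx.
by apply: count_false => B; rewrite !mem_spread_inl eq_sym (negbTE wu).
Qed.

Lemma inflate_pairs s x y : s \in cells -> x != y ->
  \sum_(i <- s) count (fun B : {set D + E} => (x \in B) && (y \in B))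
    (inflate (K i) (Es i) (Ps i)) = 2 * size s.
Proof.
case: x => [p|e]; first exact: inflate_pairs_inl.
(* Two fixed points would share the fillings of all fibres; [#|E| <= 1] rules such a pair out. *)
case: y => [q|e'] s_cell xy; last by rewrite (subsingleton_E e e') eqxx in xy.
under eq_bigr do under eq_count do rewrite andbC.
by apply: inflate_pairs_inl; rewrite // eq_sym.
Qed.

Lemma inflate_split_design : split_design (fun i => inflate (K i) (Es i) (Ps i)).
Proof.
by split; [exact: inflate_block_size | exact: inflate_replication | exact: inflate_pairs].
Qed.

End Inflation.

(** * Existence *)

Lemma Zp_mulrn_inj (w k : nat) : coprime w.+1 k -> injective (fun x : 'I_w.+1 => x *+ k)%R.
Proof.
move=> cop x y /eqP; rewrite -subr_eq0 -mulrnBl => /eqP E.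
apply/eqP; rewrite -subr_eq0; move: (x - y)%R E => {x y} z.
rewrite Zp_mulrn => /(congr1 val) /= /eqP; rewrite -/(dvdn _ _) Gauss_dvdl //.
by case: z => z zw /= /dvdn_leq; case: z zw => // z zw /(_ isT); lia.
Qed.

(** With doubling as [phi], the maps to be injective are multiplications by 2, 3 and -1. *)
Lemma level_cyclic (w : nat) : coprime w.+1 6 -> level (fun x : 'I_w.+1 => x + x)%R.
Proof.
rewrite (coprimeMr _ 2 3) => /andP[c2 c3].
have i2 := Zp_mulrn_inj c2; have i3 := Zp_mulrn_inj c3.
split=> [x|||x y|x y] /=.
- by rewrite opprD.
- exact: i2.
- exact: i2.
- by move=> E; apply: i3; exact: E.
- by rewrite !opprD !addrA !subrr !sub0r => /oppr_inj.
Qed.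

Lemma level_prod (R S : finZmodType) (phi : R -> R) (psi : S -> S) :
  level phi -> level psi ->
  level (fun x : R * S => (phi x.1, psi x.2)).
Proof.
case=> a1 a2 a3 a4 a5 [b1 b2 b3 b4 b5].
split=> [[x y]|[x y] [x' y']|[x y] [x' y']|[x y] [x' y']|[x y] [x' y']] /=.
- by rewrite a1 b1.
- by case=> /a2-> /b2->.
- by case=> /a3-> /b3->.
- by case=> /a4-> /b4->.
- by case=> /a5-> /b5->.
Qed.

(* 2 = -1 in characteristic 3, so multiplication by any y other than 0, 1, -1 works. *)
Lemma level_char3 (F : finFieldType) : 3 \in [pchar F]%R -> 3 < #|F| ->
  exists phi : F -> F, level phi.
Proof.
move=> char3 F_gt3.
have [y] : exists y : F, y \notin [:: 0; 1; -1]%R.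
  apply/existsP; apply: contraLR F_gt3; rewrite negb_exists -leqNgt => /forallP all3.
  apply: leq_trans (card_size [:: 0; 1; -1 : F]%R); apply: subset_leq_card.
  by apply/subsetP => y _; have := all3 y; rewrite negbK.
rewrite !inE !negb_or => /and3P[y0 y1 yN1]; exists (fun x => y * x)%R.
have dbl (x : F) : (x + x)%R = (- x)%R.
  apply/eqP; rewrite -subr_eq0 opprK; apply/eqP.
  by rewrite -mulr2n -mulrSr -mulr_natr (pcharf0 char3) mulr0.
split=> [x|x x'|x x'|x x'|x x'] /=.
- by rewrite mulrN.
- exact: mulfI.
- by rewrite !dbl => /oppr_inj.
- rewrite -{1}[x]mul1r -{1}[x']mul1r -!mulrDl; apply: mulfI.
  by rewrite addrC addr_eq0.
- rewrite -{1}[x]mul1r -{1}[x']mul1r -!mulrBl; apply: mulfI.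
  by rewrite subr_eq0 eq_sym.
Qed.

(** Write [w] as [m] times a power of 3, with [m] prime to 6. Doubling serves the cyclic group of
    order [m]; if the exponent is at least 2, the field of that order has a multiplier other than 0,
    1, -1. *)
Lemma level_exists (w : nat) : odd w -> logn 3 w != 1 ->
  exists (R : finZmodType) (phi : R -> R), level phi /\ #|R| = w.
Proof.
move=> w_odd log_w; have w_gt0 : 0 < w by case: w w_odd {log_w}.
have [m c3 def_w] := pfactor_coprime (isT : prime 3) w_gt0.
have m_odd : odd m by move: w_odd; rewrite def_w oddM => /andP[].
case: m c3 m_odd def_w => // m c3 m_odd def_w.
have lvl : level (fun x : 'I_m.+1 => x + x)%R.
  apply: level_cyclic; rewrite (coprimeMr _ 2 3) coprimen2 coprime_sym c3 andbT.
  exact: m_odd.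
case: (logn 3 w) log_w def_w => [|[|k]] // _ def_w.
  by exists 'I_m.+1, (fun x => x + x)%R; rewrite card_ord def_w muln1.
have [F char3 cardF] := PrimePowerField (isT : prime 3) (isT : 0 < k.+2).
have [|phi phiP] := level_char3 char3.
  by rewrite cardF !expnS; have := expn_gt0 3 k; lia.
exists ('I_m.+1 * F)%type, (fun x => (x.1 + x.1, phi x.2))%R.
split; first exact: (level_prod lvl phiP).
by rewrite card_prod card_ord cardF def_w.
Qed.

(** * Checking the label conditions by evaluation *)

Definition Zg_sub (g x y : nat) : nat := (x %% g + (g - y %% g) %% g) %% g.

(* Computable counterpart of label_diff on 'I_g, for the checks by evaluation. *)
Definition label_diff_on_nat (g : nat) (l : seq nat) (a : nat) : nat :=
  sumn [seq sumn [seq (if i != j then Zg_sub g (nth 0 l i) (nth 0 l j) == a : nat else 0)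
    | j <- iota 0 5] | i <- iota 0 5].

Definition labels_on_nat (g : nat) (Es Ps : nat -> seq (seq nat)) : bool :=
  all (fun i => all (fun l : seq nat => (nth 0 l 1 == nth 0 l 2) && (nth 0 l 3 == nth 0 l 4)) (Es i)
    && (5 * (size (Es i) + 2 * size (Ps i)) == g)) (iota 0 5) &&
  all (fun s => all (fun a =>
    sumn [seq sumn [seq label_diff_on_nat g l a | l <- Es i]
      + 2 * sumn [seq label_diff_on_nat g l a | l <- Ps i] | i <- s] == 4 * size s)
    (iota 0 g)) cells.

Lemma nth_inZp (g : nat) (l : seq nat) i :
  ([seq inZp k | k <- l]`_i)%R = inZp (nth 0 l i) :> 'I_g.+1.
Proof.
have [il|li] := ltnP i (size l); first by rewrite (nth_map 0).
by rewrite !nth_default ?size_map //; apply: val_inj; rewrite /= mod0n.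
Qed.

Lemma label_diff_of_nat (g : nat) (l : seq nat) (a : 'I_g.+1) :
  label_diff [seq inZp k | k <- l] a = label_diff_on_nat g.+1 l a.
Proof.
rewrite /label_diff_on_nat sumnE big_map; apply: eq_bigr => i _.
rewrite sumnE big_map big_mkcond; apply: eq_bigr => j _ /=.
(* The summands now agree by conversion: [Zg_sub] repeats the computation of subtraction in
   ['I_g.+1]. *)
by rewrite !nth_inZp.
Qed.

(** [A] is cyclic of order [g.+1], and [eps] is the number of fixed points. *)
Lemma split_design_exists (g eps w : nat) (K Es Ps : nat -> seq (seq nat)) :
  eps <= 1 -> split_design_on_nat (g.+1 + eps) K -> labels_on_nat g.+1 Es Ps ->
  odd w -> logn 3 w != 1 ->
  exists (V : finType) (K' : nat -> seq {set V}),
    #|V| = g.+1 * w + eps /\ split_design K'.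
Proof.
move=> eps_le1 fillP /andP[/allP lab1 /allP lab2] w_odd log_w.
have [R [phi [phiP cardR]]] := level_exists w_odd log_w.
have E_le1 : #|'I_eps| <= 1 by rewrite card_ord.
have cardF : #|{: 'I_g.+1 + 'I_eps}| = g.+1 + eps by rewrite card_sum !card_ord.
rewrite -cardF in fillP; have splitK := split_design_of_nat fillP.
pose lift (Ls : nat -> seq (seq nat)) i : seq (seq 'I_g.+1) :=
  [seq [seq inZp k | k <- l] | l <- Ls i].
have {}lab1 i : i < 5 -> _ := fun i5 => lab1 i (etrans (mem_iota 0 5 i) i5).
exists ('I_g.+1 * R + 'I_eps)%type; eexists; split;
  first by rewrite card_sum card_prod !card_ord cardR.
apply: (inflate_split_design phiP E_le1 splitK (Es := lift Es) (Ps := lift Ps)).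
- move=> i /lab1/andP[/allP ev _]; rewrite all_map; apply/allP => l /ev /=.
  by rewrite /even_label !nth_inZp => /andP[/eqP-> /eqP->]; rewrite !eqxx.
- by move=> i /lab1/andP[_ /eqP g_def]; rewrite !size_map card_ord.
- move=> s a s_cell; have /allP/(_ (a : nat)) := lab2 s s_cell.
  rewrite mem_iota ltn_ord => /(_ isT)/eqP <-.
  rewrite sumnE big_map; apply: eq_bigr => i _.
  rewrite /label_weight !big_map !sumnE !big_map.
  by congr (_ + 2 * _); apply: eq_bigr => l _; rewrite label_diff_of_nat.
Qed.

(* The labels below were found by computer search. *)
Definition even5 (i : nat) : seq (seq nat) := [:: [:: 3; 2; 2; 4; 4]].
Definition full5 (i : nat) : seq (seq nat) := [::].

Definition even15 (i : nat) : seq (seq nat) := [:: [:: 2; 0; 0; 9; 9]].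
Definition full15 (i : nat) : seq (seq nat) := [:: [:: 1; 8; 12; 13; 11]].

Definition even10 (i : nat) : seq (seq nat) :=
  if i == 0 then [:: [:: 1; 1; 1; 3; 3]; [:: 2; 9; 9; 6; 6]] else [::].
Definition full10 (i : nat) : seq (seq nat) := nth [::]
  [:: [::];
      [:: [:: 9; 0; 2; 1; 5]];
      [:: [:: 2; 6; 1; 7; 5]];
      [:: [:: 2; 7; 0; 6; 2]];
      [:: [:: 7; 7; 5; 8; 4]]] i.

Definition even30 (i : nat) : seq (seq nat) :=
  if i == 0 then [:: [:: 23; 13; 13; 20; 20]; [:: 10; 8; 8; 2; 2]] else [::].
Definition full30 (i : nat) : seq (seq nat) := nth [::]
  [:: [:: [:: 7; 5; 16; 13; 28]; [:: 5; 15; 3; 8; 21]];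
      [:: [:: 7; 17; 9; 22; 13]; [:: 8; 28; 17; 16; 27]; [:: 1; 14; 0; 15; 23]];
      [:: [:: 12; 26; 0; 25; 0]; [:: 20; 22; 26; 15; 17]; [:: 25; 12; 8; 11; 22]];
      [:: [:: 0; 6; 23; 8; 20]; [:: 27; 22; 1; 27; 29]; [:: 23; 2; 12; 1; 22]];
      [:: [:: 17; 3; 21; 29; 14]; [:: 18; 10; 4; 5; 5]; [:: 3; 15; 22; 9; 6]]] i.

Lemma labels5P : labels_on_nat 5 even5 full5. Proof. by vm_compute. Qed.
Lemma labels10P : labels_on_nat 10 even10 full10. Proof. by vm_compute. Qed.
Lemma labels15P : labels_on_nat 15 even15 full15. Proof. by vm_compute. Qed.
Lemma labels30P : labels_on_nat 30 even30 full30. Proof. by vm_compute. Qed.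

(** * The residue classes modulo 20 *)

Definition has_split_design (n : nat) : Prop :=
  exists (V : finType) (K : nat -> seq {set V}), #|V| = n /\ split_design K.

Lemma has_split_design_odd_multiple (g eps : nat) :
  (forall w, odd w -> logn 3 w != 1 -> has_split_design (g * w + eps)) ->
  (forall w, odd w -> logn 3 w != 1 -> has_split_design (3 * g * w + eps)) ->
  forall m, odd m -> has_split_design (g * m + eps).
Proof.
move=> Hg H3g m m_odd; have [log_m|] := eqVneq (logn 3 m) 1; last exact: Hg.
have /dvdnP[w def_m] : 3 %| m by have := pfactor_dvdnn 3 m; rewrite log_m expn1.
have w_gt0 : 0 < w by case: w def_m m_odd => // ->.
have -> : g * m = 3 * g * w by rewrite def_m; lia.
apply: H3g; first by move: m_odd; rewrite def_m oddM => /andP[].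
(* The exponent of 3 in the cofactor [w] is 0. *)
by move: log_m; rewrite def_m lognM // (logn_prime 3 (isT : prime 3)) addn1 => -[->].
Qed.

Lemma has_split_design_11_15 (n : nat) :
  n = 11 %[mod 20] \/ n = 15 %[mod 20] -> has_split_design n.
Proof.
case=> n_mod.
  have -> : n = 10 * (2 * (n %/ 20)).+1 + 1 by lia.
  apply: has_split_design_odd_multiple; last by lia.
  - by move=> w; exact: (@split_design_exists 9 1 w fill11 even10 full10 isT fill11P labels10P).
  - by move=> w; exact: (@split_design_exists 29 1 w fill31 even30 full30 isT fill31P labels30P).
have -> : n = 5 * (4 * (n %/ 20) + 3) + 0 by lia.
apply: has_split_design_odd_multiple; last by lia.
- by move=> w; exact: (@split_design_exists 4 0 w fill5 even5 full5 isT fill5P labels5P).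
- by move=> w; exact: (@split_design_exists 14 0 w fill15 even15 full15 isT fill15P labels15P).
Qed.

Theorem corollary7p2 (n : nat) (n_gt0 : 0 < n)
    (n_mod : n = 11 %[mod 20] \/ n = 15 %[mod 20]) (n_neq15 : n <> 15) :
  exists (X : finType) (groups : {set {set X}}) (blocks : seq {set X}),
    is_gdd n 2 6 (2 * n) (n - 1) groups blocks /\
    has_configuration 1 5 groups blocks.
Proof.
have [V [K [cardV splitK]]] := has_split_design_11_15 n_mod.
have V_gt2 : 2 < #|V| by lia.
exists (bool * V)%type, (sides V), (gdd_blocks K); rewrite -cardV.
by split; [exact: gdd_of_split_design | exact: gdd_configuration].
Qed.
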